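(* Given a string $T$ of length $n$ and a string attractor $\Gamma$ of size $\gamma$ for $T$, one can build a straight-line program (SLP) for $T$ of size $\mathcal{O}(\gamma\log^2(n/\gamma))$.
   Context: A string attractor of $T$ is a set $\Gamma\subseteq\{1,\dots,n\}$ such that every substring $T[i..j]$ has an occurrence $T[i'..j']=T[i..j]$ with $p\in[i',j']$ for some $p\in\Gamma$. A straight-line program is a context-free grammar generating exactly one string, with rules of the forms $X\rightarrow AB$ ($A,B$ nonterminals) and $X\rightarrow a$ ($a$ terminal), acyclic, with a starting nonterminal whose expansion is $T$; its size is its number of rules.
   Formalization: The logarithm log(n/γ) is read as max(1, log₂(n/γ)), since the literal bound is 0 at γ = n (for example, n distinct letters), and T is assumed non-empty, since an SLP cannot generate the empty string. *)

(* Defs.v *)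
From mathcomp Require Import all_boot all_order all_algebra.
From mathcomp Require Import all_classical all_reals all_analysis.

Set Implicit Arguments.
Unset Strict Implicit.
Unset Printing Implicit Defensive.

Import Order.TTheory GRing.Theory Num.Theory.
Local Open Scope ring_scope.

(* Positions are 0-based: 'I_n plays the role of {1, ..., n}.  [substring T i j]
   is T[i..j] with both ends included, meaningful when i <= j < size T. *)
Definition substring (A : Type) (T : seq A) (i j : nat) : seq A :=
  take (j.+1 - i) (drop i T).

Definition string_attractor (A : Type) (n : nat) (T : n.-tuple A)
    (Gamma : {set 'I_n}) : Prop :=
  forall i j : nat, (i <= j < n)%N ->
  exists i' j' : nat,
    [/\ (i' <= j' < n)%N,
        substring T i' j' = substring T i j
      & exists2 p : 'I_n, p \in Gamma & (i' <= p <= j')%N].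

(* Context-free grammars whose rules are X -> a, encoded as (X, inl a), or
   X -> Y Z, encoded as (X, inr (Y, Z)). *)
Record grammar (A : eqType) := Grammar {
  nonterminal : finType;
  rules : seq (nonterminal * (A + nonterminal * nonterminal));
  start : nonterminal
}.

Inductive expands (A : eqType) (G : grammar A) :
    nonterminal G -> seq A -> Prop :=
| expands_terminal X a :
    (X, inl a) \in rules G -> expands X [:: a]
| expands_pair X Y Z u v :
    (X, inr (Y, Z)) \in rules G -> expands Y u -> expands Z v ->
    expands X (u ++ v).

Definition occurs_in_rule (A : eqType) (G : grammar A) : rel (nonterminal G) :=
  fun X Y => has (fun r => (r.1 == X) &&
                    (if r.2 is inr (Z1, Z2) then (Y == Z1) || (Y == Z2)
                     else false))
                 (rules G).

Definition acyclic (A : eqType) (G : grammar A) : Prop :=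
  forall X Y : nonterminal G,
    occurs_in_rule X Y -> ~~ connect (@occurs_in_rule A G) Y X.

(* "Straight-line": every nonterminal is the left-hand side of exactly one
   rule. *)
Definition straight_line (A : eqType) (G : grammar A) : Prop :=
  forall X : nonterminal G, count (fun r => r.1 == X) (rules G) = 1%N.

Definition slp_for (A : eqType) (G : grammar A) (T : seq A) : Prop :=
  [/\ straight_line G, acyclic G
    & forall w : seq A, expands (start G) w <-> w = T].

Definition grammar_size (A : eqType) (G : grammar A) : nat := size (rules G).

Definition log2 (R : realType) (x : R) : R := ln x / ln 2.

(* The usual convention for logarithms inside asymptotic bounds: log x stands
   for max(1, log_2 x).  Without it O(g log^2(n/g)) would be O(0) at g = n. *)
Definition log2_ge1 (R : realType) (x : R) : R := Num.max 1 (log2 x).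

(* Main.v *)
(** Represent a straight-line program by a list of binary parse trees closed
    under taking children, so that its size is the number of distinct subtrees.
    Any substring of the yield of a tree of height [h] is the yield of a tree of
    height at most [h] using at most [2 h] new subtrees: trim the two spines
    below the node where the substring splits.

    Let [W_k p] be the window of radius [2^k] around an attractor position [p].
    Every substring of length at most [2^k] has an occurrence inside some
    [W_k p], and [W_(k+1) p] is a concatenation of four such substrings.  Hence
    trees of height [2 k] for all the [W_k p] give trees of height [2 k + 2] for
    all the [W_(k+1) p] at the cost of [O(k)] new subtrees for each [p].
    Iterating up to the least [K] with [n <= gamma 2^K] costs
    [O(gamma K^2)], after which [T] is the concatenation of at most [gamma]
    blocks of length at most [2^K], each cut out of a window at cost [O(K)]. *)
Require Import Defs.
From HB Require Import structures.
From mathcomp Require Import all_boot all_order all_algebra.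
From mathcomp Require Import all_classical all_reals all_analysis.
From mathcomp Require Import zify lra.

Set Implicit Arguments.
Unset Strict Implicit.
Unset Printing Implicit Defensive.

Import Order.TTheory GRing.Theory Num.Theory.
Local Open Scope nat_scope.

(** * Parse trees, and the cost of cutting and joining their yields *)

Inductive tree (A : Type) : Type :=
| leaf of A
| node of tree A & tree A.

(** Equality of trees is decided classically, so lists of trees have a membership test over any type
    [A]. *)
HB.instance Definition _ (A : Type) := gen_eqMixin (tree A).

Section Trees.
Variable A : Type.
Implicit Types (t l r : tree A) (s : seq (tree A)) (w : seq A).

Fixpoint yield t : seq A :=
  match t with
  | leaf a => [:: a]
  | node l r => yield l ++ yield r
  end.

Fixpoint height t : nat :=
  match t with
  | leaf _ => 0
  | node l r => (maxn (height l) (height r)).+1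
  end.

Definition child_closed s : Prop :=
  forall l r, node l r \in s -> l \in s /\ r \in s.

Definition extends s s' (c : nat) : Prop :=
  [/\ {subset s <= s'}, child_closed s' & size s' <= size s + c].

(** The height is tracked along with the cost because it bounds the price of later cuts. *)
Definition buildable s (c h : nat) w : Prop :=
  exists s' t, [/\ extends s s' c, t \in s', height t <= h & yield t = w].

Lemma extends_refl s : child_closed s -> extends s s 0.
Proof. by move=> cs; split=> //; lia. Qed.

Lemma extends_trans s1 s2 s3 c1 c2 :
  extends s1 s2 c1 -> extends s2 s3 c2 -> extends s1 s3 (c1 + c2).
Proof.
move=> [s12 _ z12] [s23 cl3 z23]; split=> //; last by lia.
by move=> t /s12 /s23.
Qed.

Lemma extends_le s s' c c' : c <= c' -> extends s s' c -> extends s s' c'.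
Proof. by move=> le [? ? ?]; split=> //; lia. Qed.

Lemma extends_node s l r :
  child_closed s -> l \in s -> r \in s -> extends s (node l r :: s) 1.
Proof.
move=> cs ls rs; split; [|move=> l' r'|by rewrite /=; lia].
  by move=> t; rewrite inE => ->; rewrite orbT.
rewrite inE => /orP[/eqP[-> ->]|/cs[l's r's]].
  by rewrite !inE ls rs !orbT.
by rewrite !inE l's r's !orbT.
Qed.

Lemma buildable_mem s t : child_closed s -> t \in s ->
  buildable s 0 (height t) (yield t).
Proof. by move=> cs ts; exists s, t; split=> //; exact: extends_refl. Qed.

Lemma buildable_le s c c' h h' w :
  c <= c' -> h <= h' -> buildable s c h w -> buildable s c' h' w.
Proof.
move=> lec leh [s' [t [e ts' ht yt]]]; exists s', t; split=> //.
  exact: extends_le e.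
exact: leq_trans leh.
Qed.

Lemma buildable_cat s c1 c2 h1 h2 u v :
  buildable s c1 h1 u ->
  (forall s', extends s s' c1 -> buildable s' c2 h2 v) ->
  buildable s (c1 + c2).+1 (maxn h1 h2).+1 (u ++ v).
Proof.
move=> [s1 [t1 [e1 t1s h1t y1]]] /(_ _ e1) [s2 [t2 [e2 t2s h2t y2]]].
have [s12 cl2 _] := e2.
exists (node t1 t2 :: s2), (node t1 t2); split.
- rewrite -addn1; apply: extends_trans (extends_trans e1 e2) _.
  exact: extends_node (s12 _ t1s) t2s.
- exact: mem_head.
- by rewrite /= ltnS geq_max !leq_max h1t h2t orbT.
- by rewrite /= y1 y2.
Qed.

(** Only the path to the cut is rebuilt: each level either discards the left child or adds one node
    that reuses the right child unchanged. *)
Lemma buildable_drop s t i : child_closed s -> t \in s ->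
  i < size (yield t) -> buildable s (height t) (height t) (drop i (yield t)).
Proof.
move=> cs; elim: t i => [a|l IHl r IHr] i ts; rewrite /= ?size_cat => ilt.
  have -> : i = 0 by lia.
  exact: (buildable_mem cs ts).
have [ls rs] := cs _ _ ts; rewrite drop_cat; case: ltnP => il.
  apply: (@buildable_le _ (height l + 0).+1 _ (maxn (height l) (height r)).+1);
    [by lia|by lia|].
  apply: buildable_cat (IHl i ls il) _ => s' [ss' cs' _].
  exact: buildable_mem (ss' _ rs).
by apply: (@buildable_le _ (height r) _ (height r)); [lia|lia|apply: IHr => //; lia].
Qed.

Lemma buildable_take s t m : child_closed s -> t \in s ->
  0 < m -> buildable s (height t) (height t) (take m (yield t)).
Proof.
move=> cs; elim: t m => [a|l IHl r IHr] m ts m0.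
  have -> : take m (yield (leaf a)) = yield (leaf a) by case: m m0.
  exact: buildable_mem.
have [ls rs] := cs _ _ ts; rewrite [yield _]/= take_cat.
case: ltnP => ml.
  by apply: (@buildable_le _ (height l) _ (height l)); rewrite /=; [lia|lia|exact: IHl].
have [->|ne] := eqVneq (m - size (yield l)) 0.
  rewrite take0 cats0.
  by apply: (@buildable_le _ 0 _ (height l)); rewrite /=; [lia|lia|exact: buildable_mem].
(* The induction hypothesis concerns [s] itself, so the right part is built first and [l] is reused,
   the opposite of the order in [buildable_cat]. *)
have [s' [t' [e t's ht' yt']]] : buildable s (height r) (height r)
    (take (m - size (yield l)) (yield r)) by apply: IHr => //; lia.
have [ss' cs' _] := e.
exists (node l t' :: s'), (node l t'); split.
- apply: (@extends_le _ _ (height r + 1)); first by rewrite /=; lia.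
  exact: extends_trans e (extends_node cs' (ss' _ ls) t's).
- exact: mem_head.
- by rewrite /=; lia.
- by rewrite /= yt'.
Qed.

Lemma buildable_substring s t i m : child_closed s -> t \in s ->
  0 < m -> i + m <= size (yield t) ->
  buildable s (2 * height t) (height t) (take m (drop i (yield t))).
Proof.
move=> cs; elim: t i m => [a|l IHl r IHr] i m ts m0; rewrite /= ?size_cat => im.
  have [-> ->] : i = 0 /\ m = 1 by lia.
  exact: (buildable_mem cs ts).
have [ls rs] := cs _ _ ts; rewrite drop_cat; case: ltnP => il; last first.
  apply: (@buildable_le _ (2 * height r) _ (height r)); [lia|lia|].
  by apply: IHr => //; lia.
rewrite take_cat size_drop; case: ltnP => ml.
  apply: (@buildable_le _ (2 * height l) _ (height l)); [lia|lia|].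
  by apply: IHl => //; lia.
have [->|ne] := eqVneq (m - (size (yield l) - i)) 0.
  rewrite take0 cats0.
  apply: (@buildable_le _ (height l) _ (height l)); [lia|lia|].
  exact: buildable_drop.
(* The cut straddles this node: a suffix of [l], a prefix of [r] and one joining node. *)
apply: (@buildable_le _ (height l + height r).+1 _ (maxn (height l) (height r)).+1);
  [lia|lia|].
apply: buildable_cat (buildable_drop cs ls il) _ => s' [ss' cs' _].
by apply: buildable_take => //; [exact: ss'|lia].
Qed.

End Trees.

(** * Building factors of a text from a list of trees *)

Section Blocks.
Variables (A : Type) (T : seq A).
Implicit Types (s : seq (tree A)) (L c h : nat).

Definition covers s L h : Prop :=
  forall i m, 0 < m <= L -> i + m <= size T ->
  exists t a, [/\ t \in s, height t <= h, a + m <= size (yield t)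
                & take m (drop a (yield t)) = take m (drop i T)].

(** Quantifying over closed supersets keeps the property usable, at the same cost, while the list
    grows. *)
Definition factors_buildable s L c h : Prop :=
  forall s', {subset s <= s'} -> child_closed s' ->
  forall i m, 0 < m <= L -> i + m <= size T ->
  buildable s' c h (take m (drop i T)).

Lemma covers_buildable s L h : covers s L h -> factors_buildable s L (2 * h) h.
Proof.
move=> cov s' ss' cs' i m mL im.
have [t [a [ts th am <-]]] := cov i m mL im.
apply: (@buildable_le _ _ (2 * height t) _ (height t)); [lia|lia|].
by apply: buildable_substring => //; [exact: ss'|lia].
Qed.

Lemma factors_buildable_add s L1 L2 c1 c2 h1 h2 : 0 < L1 ->
  factors_buildable s L1 c1 h1 -> factors_buildable s L2 c2 h2 ->
  factors_buildable s (L1 + L2) (c1 + c2).+1 (maxn h1 h2).+1.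
Proof.
move=> L1_gt0 B1 B2 s' ss' cs' i m mL im.
have [mL1|mL1] := leqP m L1.
  by apply: (@buildable_le _ _ c1 _ h1); [lia|lia|apply: B1 => //; lia].
have -> : m = L1 + (m - L1) by lia.
rewrite takeD drop_drop; apply: buildable_cat; first by apply: B1 => //; lia.
move=> s'' [ss'' cs'' _]; apply: B2 => //; try lia.
by move=> t /ss' /ss''.
Qed.

Lemma factors_buildable_mul s L c h b : 0 < L -> 0 < b ->
  factors_buildable s L c h -> factors_buildable s (b * L) (b * c.+1) (h + b).
Proof.
move=> L_gt0 b_gt0 B; case: b b_gt0 => // b _.
elim: b => [|b IH] s' ss' cs' i m mL im.
  by apply: (@buildable_le _ _ c _ h); [lia|lia|apply: B => //; lia].
apply: (@buildable_le _ _ (c + b.+1 * c.+1).+1 _ (maxn h (h + b.+1)).+1); [lia|lia|].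
by apply: (factors_buildable_add L_gt0 B IH) => //; lia.
Qed.

Lemma extends_windows s (P : seq nat) L c h (wa wm : nat -> nat) :
  child_closed s -> factors_buildable s L c h ->
  (forall p, p \in P -> 0 < wm p <= L /\ wa p + wm p <= size T) ->
  exists2 s', extends s s' (size P * c) &
    forall p, p \in P -> exists2 t, t \in s' &
      height t <= h /\ yield t = take (wm p) (drop (wa p) T).
Proof.
move=> cs B; elim: P => [|p P IH] HP; first by exists s => //; exact: extends_refl.
have [|s1 e1 H1] := IH; first by move=> q qP; apply: HP; rewrite inE qP orbT.
have [ss1 cs1 _] := e1.
have [wL wn] := HP p (mem_head _ _).
have [s2 [t [e2 ts2 th ty]]] := B s1 ss1 cs1 _ _ wL wn.
have [s12 _ _] := e2.
exists s2; first by rewrite /= mulSn addnC; exact: extends_trans e1 e2.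
move=> q; rewrite inE => /orP[/eqP->|/H1[t' t's ht']]; first by exists t.
by exists t' => //; exact: s12.
Qed.

End Blocks.

(** * Windows around attractor positions *)

Section Attractor.
Variables (A : Type) (n : nat) (T : n.-tuple A) (Gamma : {set 'I_n}).
Hypothesis attrT : string_attractor T Gamma.

Lemma attractor_occurrence i m : 0 < m -> i + m <= n ->
  exists i' (p : 'I_n), [/\ p \in Gamma, i' <= p < i' + m, i' + m <= n
                          & take m (drop i' T) = take m (drop i T)].
Proof.
move=> m0 im; have ij : i <= (i + m).-1 < n by lia.
have [i' [j' [ij' eqs [p pG pij]]]] := attrT ij.
have sz := congr1 size eqs.
rewrite /substring !size_takel ?size_drop ?size_tuple in sz; try lia.
have mi : (i + m).-1.+1 - i = m by lia.
have mi' : j'.+1 - i' = m by rewrite sz.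
move: eqs; rewrite /substring mi mi' => eqs.
by exists i', p; split=> //; lia.
Qed.

Lemma attractor_gt0 : 0 < n -> 0 < #|Gamma|.
Proof.
move=> n0; have [|? [p [pG _ _ _]]] := @attractor_occurrence 0 1 isT; first by lia.
by apply/card_gt0P; exists p.
Qed.

Lemma covers_leaves :
  covers T [seq leaf (tnth T p) | p <- enum Gamma] 1 0.
Proof.
move=> i m m1; rewrite size_tuple => im; have -> : m = 1 by lia.
have [||i' [p [pG ip _ eqT]]] := @attractor_occurrence i 1; [lia|lia|].
exists (leaf (tnth T p)), 0; split=> //.
  by apply: map_f; rewrite mem_enum.
have ip' : i' = p by lia.
rewrite -eqT ip' [in RHS](drop_nth (tnth T p)) ?size_tuple //=.
by rewrite take0 -tnth_nth.
Qed.

Lemma covers_double s L h : 0 < L -> child_closed s -> covers T s L h ->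
  exists2 s', extends s s' (#|Gamma| * (8 * h + 3)) & covers T s' (2 * L) (h + 2).
Proof.
move=> L0 cs /covers_buildable B1.
have B2 := factors_buildable_add L0 B1 B1.
have L20 : 0 < L + L by lia.
have B4 := factors_buildable_add L20 B2 B2.
(* An interval of length at most [2 * L] through [p] lies in [[p + 1 - 2L, p + 2L)], which has fewer
   than [4 * L] positions; truncated subtraction and [minn] clip it to the text. *)
pose wa p := p.+1 - 2 * L; pose wm p := minn n (p + 2 * L) - wa p.
have [|s' e H] := @extends_windows _ T s [seq val p | p <- enum Gamma] _ _ _ wa wm cs B4.
  move=> _ /mapP[p _ ->]; have := ltn_ord p; rewrite /= size_tuple /wm /wa; lia.
exists s'.
  by apply: extends_le e; rewrite size_map -cardE leq_mul2l; lia.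
move=> i m m1; rewrite size_tuple => im.
have [|i' [p [pG ip in' eqT]]] := attractor_occurrence _ im; first by lia.
have [|t ts [th ty]] := H p; first by apply: map_f; rewrite mem_enum.
have pn := ltn_ord p.
have szw : i' - wa p + m <= wm p by rewrite /wm /wa; lia.
exists t, (i' - wa p); split=> //; first by lia.
  by rewrite ty size_takel // size_drop size_tuple /wm; lia.
rewrite ty -eqT take_drop take_takel; last by rewrite addnC.
rewrite -take_drop drop_drop.
by congr (take _ (drop _ _)); rewrite /wa; lia.
Qed.

(** Per attractor position there is one leaf, and doubling number [k] starts from height [2k] and so
    costs [16k + 3]; summing over [k < K] gives [8K^2 - 5K]. *)
Lemma covers_pow2 K : exists s, [/\ child_closed s,
  size s <= #|Gamma| * (8 * K ^ 2 + 1 - 5 * K) & covers T s (2 ^ K) (2 * K)].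
Proof.
elim: K => [|K [s [cs zs cov]]].
  exists [seq leaf (tnth T p) | p <- enum Gamma]; split.
  - by move=> l r /mapP[].
  - by rewrite size_map -cardE leq_pmulr.
  - exact: covers_leaves.
have [|s' [_ cs' zs'] cov'] := covers_double _ cs cov; first by rewrite expn_gt0.
exists s'; split=> //; last by rewrite expnS mulnS addnC.
apply: leq_trans zs' _; apply: leq_trans (leq_add zs (leqnn _)) _.
by rewrite -mulnDr leq_mul2l; apply/orP; right; nia.
Qed.

Lemma attractor_tree K : 0 < n -> n <= #|Gamma| * 2 ^ K ->
  exists s t, [/\ child_closed s, t \in s, yield t = T
                & size s <= #|Gamma| * (8 * K ^ 2 + 2)].
Proof.
move=> n0 nK; have [s [cs zs /covers_buildable B]] := covers_pow2 K.
have L0 : 0 < 2 ^ K by rewrite expn_gt0.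
have := factors_buildable_mul L0 (attractor_gt0 n0) B.
move=> /(_ s (fun _ => id) cs 0 n) [||s' [t [[_ cs' zs'] ts' _ ty]]].
- by rewrite n0.
- by rewrite size_tuple.
exists s', t; split=> //.
  by rewrite ty drop0 take_oversize ?size_tuple.
(* Each of the [#|Gamma|] blocks costs at most [4K + 1], and [(8K^2 + 1 - 5K) + (4K + 1)] is at most
   [8K^2 + 2]. *)
apply: leq_trans zs' _; apply: leq_trans (leq_add zs (leqnn _)) _.
by rewrite -mulnDr leq_mul2l; apply/orP; right; nia.
Qed.

End Attractor.

(** * From a closed list of trees to a straight-line program *)

Section TreeGrammar.
Variables (A : eqType) (s : seq (tree A)).
Hypothesis closed_s : child_closed s.

Definition tree_at (i : 'I_(size s)) : tree A := tnth (in_tuple s) i.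

(* [i] is only a default value: children of trees in [s] do occur in [s]. *)
Definition child_index (i : 'I_(size s)) (t : tree A) : 'I_(size s) :=
  insubd i (index t s).

Definition tree_rule (i : 'I_(size s)) : A + 'I_(size s) * 'I_(size s) :=
  match tree_at i with
  | leaf a => inl a
  | node l r => inr (child_index i l, child_index i r)
  end.

(** Nonterminals are positions in [s], which form a finite type. A repeated tree merely yields
    several nonterminals with the same expansion. *)
Definition tree_grammar (x : 'I_(size s)) : grammar A :=
  Grammar [seq (i, tree_rule i) | i <- enum 'I_(size s)] x.

Lemma tree_atP i : tree_at i \in s.
Proof. exact: mem_tnth. Qed.

Lemma tree_at_child_index i t : t \in s -> tree_at (child_index i t) = t.
Proof.
move=> ts; rewrite /tree_at (tnth_nth t) /= val_insubd index_mem ts.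
exact: nth_index.
Qed.

Lemma mem_tree_rules x i b : ((i, b) \in rules (tree_grammar x)) = (b == tree_rule i).
Proof.
apply/mapP/eqP => [[j _ [-> ->]]//|->]; exists i => //.
by rewrite mem_enum.
Qed.

(** Height is the measure that rules out cycles. *)
Lemma occurs_in_tree_rule x (i j : nonterminal (tree_grammar x)) :
  occurs_in_rule i j -> height (tree_at j) < height (tree_at i).
Proof.
move=> /hasP[[i' b] ib /= /andP[/eqP ii']]; move: ib.
rewrite ii' mem_tree_rules => /eqP->.
have := tree_atP i; rewrite /tree_rule; case: (tree_at i) => //= l r /closed_s[ls rs].
by case/orP => /eqP->; rewrite tree_at_child_index // ltnS leq_max leqnn ?orbT.
Qed.

Lemma connect_tree_rule x (i j : nonterminal (tree_grammar x)) :
  connect (@occurs_in_rule A (tree_grammar x)) i j ->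
  height (tree_at j) <= height (tree_at i).
Proof.
case/connectP => p + ->; elim: p i => //= k p IH i /andP[/occurs_in_tree_rule ik /IH].
by move=> /leq_trans; apply; exact: ltnW.
Qed.

Lemma expands_tree_at x (i : nonterminal (tree_grammar x)) w :
  expands i w <-> w = yield (tree_at i).
Proof.
split.
  elim=> {i w} [i a|i j k u v].
    by rewrite mem_tree_rules /tree_rule => /eqP; case: (tree_at i) => // b [->].
  rewrite mem_tree_rules /tree_rule => /eqP; have := tree_atP i.
  case: (tree_at i) => // l r /closed_s[ls rs] [-> ->] _ + _.
  by rewrite !tree_at_child_index // => -> ->.
(* Naming the tree allows structural induction on it while the position [i] varies. *)
move=> ->; have [t] : exists t, t = tree_at i by exists (tree_at i).
elim: t i => [a|l IHl r IHr] i ti; have := tree_atP i; rewrite -ti /=.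
  move=> _; apply: expands_terminal.
  by rewrite mem_tree_rules /tree_rule -ti.
move=> /closed_s[ls rs].
apply: (@expands_pair _ _ _ (child_index i l : nonterminal (tree_grammar x))
   (child_index i r : nonterminal (tree_grammar x))).
- by rewrite mem_tree_rules /tree_rule -ti.
- by rewrite -{2}(tree_at_child_index i ls); apply: IHl; rewrite tree_at_child_index.
- by rewrite -{2}(tree_at_child_index i rs); apply: IHr; rewrite tree_at_child_index.
Qed.

Lemma slp_for_tree_grammar x : slp_for (tree_grammar x) (yield (tree_at x)).
Proof.
split=> [i|i j ij|w]; last exact: expands_tree_at.
- rewrite /= count_map (@eq_count _ _ (pred1 i)) //.
  by rewrite count_uniq_mem ?enum_uniq // mem_enum.
- apply/negP => /connect_tree_rule; rewrite leqNgt => /negP; apply.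
  exact: occurs_in_tree_rule.
Qed.

Lemma size_tree_grammar x : grammar_size (tree_grammar x) = size s.
Proof. by rewrite /grammar_size size_map size_enum_ord. Qed.

End TreeGrammar.

Lemma exists_tree_slp (A : eqType) (s : seq (tree A)) t :
  child_closed s -> t \in s ->
  exists2 G : grammar A, slp_for G (yield t) & grammar_size G = size s.
Proof.
move=> cs ts; have ti : index t s < size s by rewrite index_mem.
exists (tree_grammar (Ordinal ti)); last exact: size_tree_grammar.
have {2}-> : t = tree_at (Ordinal ti) by rewrite /tree_at (tnth_nth t) /= nth_index.
exact: slp_for_tree_grammar.
Qed.

(** * Choice of the number of doublings and the final bound *)

Local Open Scope ring_scope.

(** For the least such [K], if positive, [g * 2 ^ (K - 1) < n] gives [K - 1 <= log2 (n / g)]; the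
    remaining 1 is absorbed because [log2_ge1] is at least 1. *)
Lemma exists_pow2_log2_ge1 (R : realType) (n g : nat) : (0 < n)%N -> (0 < g)%N ->
  exists2 K, (n <= g * 2 ^ K)%N & K%:R <= 2 * log2_ge1 (n%:R / g%:R : R).
Proof.
move=> n0 g0.
have exK : exists K, (n <= g * 2 ^ K)%N.
  exists n; apply: leq_trans (ltnW (ltn_expl n (ltnSn 1))) _.
  by rewrite leq_pmull.
case: (ex_minnP exK) => K nK minK; exists K => //.
set y : R := log2_ge1 _.
have y1 : 1 <= y by rewrite /y /log2_ge1 le_max lexx.
case: K nK minK => [|K] nK minK; first by lra.
suff : K%:R <= y by rewrite -natr1; lra.
have lt : (g * 2 ^ K < n)%N by rewrite ltnNge; apply/negP => /minK; rewrite ltnn.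
have gR : 0 < g%:R :> R by rewrite ltr0n.
have ln2 : 0 < ln 2 :> R by rewrite ln_gt0 // ltr1n.
rewrite /y /log2_ge1 le_max; apply/orP; right.
rewrite /log2 ler_pdivlMr // [leLHS]mulr_natl -lnXn ?ltr0n // ler_ln ?posrE.
- by rewrite ler_pdivlMr // mulrC -natrX -natrM ler_nat ltnW.
- by rewrite exprn_gt0 // ltr0n.
- by rewrite divr_gt0 // ltr0n.
Qed.

Theorem theorem3p14 (R : realType) :
  exists C : R,
  forall (A : eqType) (n : nat) (T : n.-tuple A) (Gamma : {set 'I_n}),
    (0 < n)%N -> string_attractor T Gamma ->
    exists G : grammar A,
      slp_for G T /\
      (grammar_size G)%:R
        <= C * (#|Gamma|%:R * log2_ge1 (n%:R / #|Gamma|%:R) ^+ 2).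
Proof.
(* With [y] the logarithmic factor, [K <= 2y] and [1 <= y] give [8K^2 + 2 <= 32y^2 + 2y^2]. *)
exists 34 => A n T Gamma n0 attrT.
have [K nK Klog] := exists_pow2_log2_ge1 R n0 (attractor_gt0 attrT n0).
have [s [t [cs ts ty zs]]] := attractor_tree attrT n0 nK.
have [G slpG zG] := exists_tree_slp cs ts.
exists G; split; first by rewrite -ty.
set y : R := log2_ge1 _ in Klog *.
have y1 : 1 <= y by rewrite /y /log2_ge1 le_max lexx.
rewrite mulrCA; apply: (@le_trans _ _ (#|Gamma| * (8 * K ^ 2 + 2))%:R).
  by rewrite ler_nat zG.
rewrite natrM ler_wpM2l ?ler0n // natrD natrM natrX.
have K0 : 0 <= K%:R :> R by rewrite ler0n.
by nra.
Qed.
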